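(* There exists a Kolmogorov numbering $\psi$ such that for every computable function $f$ mapping each index $x$ to a finite list of indices containing $\min_\psi(x)$, it holds that $|f(x)|=\Omega(x)$ for infinitely many $x$; that is, there is a constant $c>0$ with $|f(x)|\ge cx$ for infinitely many $x$.
   Context: A numbering $\psi$ is given by a partial-recursive function $U:\mathbb{N}^2\to\mathbb{N}$ via $\psi_e(x)=U(e,x)$. A Kolmogorov numbering is a numbering $\psi$ such that for every numbering $\theta$ there exist a computable function $t$ and a constant $c>0$ with $\psi_{t(e)}=\theta_e$ and $t(e)\le ce+c$ for all $e$. $\min_\psi(e)$ is the least $j$ with $\psi_j=\psi_e$. $|f(x)|$ denotes the number of elements of the list $f(x)$. *)

(* Defs.v *)
From mathcomp Require Import all_boot.
From mathcomp Require Import boolp.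

Set Implicit Arguments.
Unset Strict Implicit.
Unset Printing Implicit Defensive.

(* Kleene's mu-recursive functions of arity k, as syntax.  [RMu] minimizes and
   [RRec] recurses over the first argument. *)
Inductive recfun : nat -> Type :=
| RZero k : recfun k
| RSucc : recfun 1
| RProj k (i : 'I_k) : recfun k
| RComp k m (f : recfun m) (gs : 'I_m -> recfun k) : recfun k
| RRec k (f : recfun k) (g : recfun k.+2) : recfun k.+1
| RMu k (f : recfun k.+1) : recfun k.

(* [eval p xs y] : the partial function denoted by [p] is defined at [xs] with
   value [y].  In the [RRec] case, [s i] is the value after [i] steps. *)
Fixpoint eval k (p : recfun k) : k.-tuple nat -> nat -> Prop :=
  match p in recfun k return k.-tuple nat -> nat -> Prop with
  | RZero _ => fun _ y => y = 0
  | RSucc => fun xs y => y = (thead xs).+1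
  | RProj _ i => fun xs y => y = tnth xs i
  | RComp _ m f gs => fun xs y =>
      exists2 ys : m.-tuple nat,
        forall i, eval (gs i) xs (tnth ys i) & eval f ys y
  | RRec _ f g => fun xs y =>
      exists s : nat -> nat,
        [/\ eval f (behead_tuple xs) (s 0),
            forall i, i < thead xs ->
              eval g [tuple of i :: s i :: behead_tuple xs] (s i.+1)
          & y = s (thead xs)]
  | RMu _ f => fun xs y =>
      eval f [tuple of y :: xs] 0 /\
      forall i, i < y -> exists v, eval f [tuple of i :: xs] v.+1
  end.

(* Partial functions are [option]-valued, [None] meaning undefined. *)
Definition partial_recursive k (F : k.-tuple nat -> option nat) : Prop :=
  exists p : recfun k, forall xs y, F xs = Some y <-> eval p xs y.

Definition computable (t : nat -> nat) : Prop :=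
  partial_recursive (fun xs : 1.-tuple nat => Some (t (thead xs))).

(* [CodeSeq.code] is MathComp's effective bijection from [seq nat] to [nat]. *)
Definition computable_list (f : nat -> seq nat) : Prop :=
  computable (fun x => CodeSeq.code (f x)).

Definition numbering (psi : nat -> nat -> option nat) : Prop :=
  partial_recursive
    (fun xs : 2.-tuple nat => psi (tnth xs ord0) (tnth xs ord_max)).

Definition kolmogorov_numbering (psi : nat -> nat -> option nat) : Prop :=
  numbering psi /\
  forall theta, numbering theta ->
    exists (t : nat -> nat) (c : nat),
      [/\ computable t, 0 < c, forall e, psi (t e) = theta e
        & forall e, t e <= c * e + c].

Lemma index_exists (psi : nat -> nat -> option nat) e :
  exists j, `[< psi j = psi e >].
Proof. by exists e; apply/asboolP. Qed.

Definition min_index (psi : nat -> nat -> option nat) (e : nat) : nat :=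
  ex_minn (index_exists psi e).

(* Main.v *)
Require Import Defs.
From mathcomp Require Import all_boot all_order all_algebra.
From mathcomp Require Import boolp zify lra.

Set Implicit Arguments.
Unset Strict Implicit.
Unset Printing Implicit Defensive.

(* The numbering [psi] carries a universal numbering [phi] on the multiples of
   8: psi_(8 * 2^d * (2k+1)) = phi_d(k, .).  Other indices lie in blocks
   [B <= e < 5B], where [B] is a power of 8; each [d] owns infinitely many blocks.
   For [x] in the top part [4B <= x < 5B], psi_x is the constant [x].  As soon as
   finite lists f(x) = phi_d(x) have been computed for all these [x] and the
   [x] can be matched injectively to indices [a] in the rest of the block with [a] not in
   f(x), psi_a becomes the constant [x] as well, so that the minimal index of
   psi_x is below [x].  It cannot be another index of a block without falling
   outside f(x), so if f is correct then it is a multiple of 8.  But there are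
   only 5B/8 multiples of 8 below 5B, and 7B/8 such [x].  So no matching exists,
   and by the greedy algorithm some f(x) has more than B > x/5 elements.
   A universal numbering is obtained from the fact that y = phi_d(xs) holds iff
   some finite set of triples (code, arguments, value) contains (d, xs, y) and
   is closed under the evaluation rules read backwards. *)

Lemma eval_det k (p : recfun k) xs y z : eval p xs y -> eval p xs z -> y = z.
Proof.
elim: p xs y z => {k} /=.
- by move=> k xs y z -> ->.
- by move=> xs y z -> ->.
- by move=> k i xs y z -> ->.
- move=> k m f IHf gs IHgs xs y z [ys gys fy] [zs gzs fz].
  have ezy : ys = zs by apply: eq_from_tnth => i; apply: IHgs (gys i) (gzs i).
  by rewrite -ezy in fz; apply: IHf fy fz.
- move=> k f IHf g IHg xs y z [s [s0 sS ->]] [s' [s'0 s'S ->]].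
  (* The two traces agree at every stage up to the counter, so the induction runs over the stages
     below [thead xs]. *)
  elim: {1 3 4}(thead xs) (leqnn (thead xs)) => [_|n IHn ltn].
    exact: IHf s0 s'0.
  have := s'S n ltn; rewrite -IHn; last exact: ltnW.
  exact: IHg (sS n ltn).
- move=> k f IHf xs y z [fy y_min] [fz z_min].
  case: (ltngtP y z) => // lt.
    by have [v fv] := z_min _ lt; have := IHf _ _ _ fy fv.
  by have [v fv] := y_min _ lt; have := IHf _ _ _ fz fv.
Qed.

(** * Computable functions of an environment *)

(* Environments are sequences read through [nth 0], so that a function of named
   variables becomes one of de Bruijn indices, of any arity at once. *)
Definition cfun (F : seq nat -> nat) : Prop :=
  forall k, exists p : recfun k, forall xs : k.-tuple nat, eval p xs (F xs).

(** Maps between environments. The output length depends on the arity [k] alone, so that one [RComp]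
    can feed the whole output to a program. *)
Definition cfuns (H : seq nat -> seq nat) : Prop :=
  forall k, exists m (gs : 'I_m -> recfun k), forall xs : k.-tuple nat,
    size (H xs) = m /\ forall i, eval (gs i) xs (nth 0 (H xs) i).

Lemma cfun_ext F G : F =1 G -> cfun F -> cfun G.
Proof. by move=> eFG cF k; have [p pP] := cF k; exists p => xs; rewrite -eFG. Qed.

Lemma cfun_comp F H : cfun F -> cfuns H -> cfun (fun e => F (H e)).
Proof.
move=> cF cH k; have [m [gs gsP]] := cH k; have [p pP] := cF m.
exists (RComp p gs) => xs /=; have [sz gsE] := gsP xs.
have szP : size (H xs) == m by apply/eqP.
exists (Tuple szP) => [i|]; last exact: (pP (Tuple szP)).
by rewrite (tnth_nth 0).
Qed.

Lemma cfun_nth i : cfun (fun e => nth 0 e i).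
Proof.
move=> k; case: (ltnP i k) => [ltik|leki].
  by exists (RProj (Ordinal ltik)) => xs /=; rewrite (tnth_nth 0).
by exists (RZero k) => xs /=; rewrite nth_default // size_tuple.
Qed.

Lemma cfuns_id : cfuns id.
Proof.
move=> k; exists k, (@RProj k) => xs; split; first exact: size_tuple.
by move=> i /=; rewrite (tnth_nth 0).
Qed.

Lemma cfuns_nil : cfuns (fun=> [::]).
Proof. by move=> k; exists 0, (fun=> RZero k) => xs; split=> // -[]. Qed.

Lemma cfuns_behead H : cfuns H -> cfuns (fun e => behead (H e)).
Proof.
move=> cH k; have [m [gs gsP]] := cH k; case: m gs gsP => [|m] gs gsP.
  exists 0, gs => xs; have [/size0nil -> _] := gsP xs; split=> // -[] //.
exists m, (fun i => gs (lift ord0 i)) => xs; have [sz gsE] := gsP xs.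
by split=> [|i]; rewrite ?size_behead ?sz // nth_behead; exact: gsE.
Qed.

Lemma cfuns_cons F H : cfun F -> cfuns H -> cfuns (fun e => F e :: H e).
Proof.
move=> cF cH k; have [m [gs gsP]] := cH k; have [p pP] := cF k.
exists m.+1, (fun i => if unlift ord0 i is Some j then gs j else p) => xs.
have [sz gsE] := gsP xs; split=> [|i] /=; first by rewrite sz.
by case: unliftP => [j|] -> //=.
Qed.

Lemma cfun_succ F : cfun F -> cfun (fun e => (F e).+1).
Proof.
move=> cF k; have [p pP] := cF k; exists (RComp RSucc (fun=> p)) => xs /=.
by exists [tuple F xs] => // i; rewrite (tnth_nth 0) ord1.
Qed.

Lemma cfun_const n : cfun (fun=> n).
Proof. by elim: n => [k|n IHn]; [exists (RZero k) | apply: cfun_succ]. Qed.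

Lemma cfun_behead F : cfun F -> cfun (fun e => F (behead e)).
Proof. by move=> cF; apply: cfun_comp => //; apply/cfuns_behead/cfuns_id. Qed.

Lemma cfun_iteri N H F :
    cfun N -> cfun (fun e => H (nth 0 e 0) (nth 0 e 1) (behead (behead e))) ->
  cfun F -> cfun (fun e => iteri (N e) (fun i a => H i a e) (F e)).
Proof.
move=> cN cH cF.
pose I e := iteri (head 0 e) (fun i a => H i a (behead e)) (F (behead e)).
suff cI : cfun I.
  apply: (cfun_comp (H := fun e => N e :: e) cI).
  by apply: cfuns_cons => //; exact: cfuns_id.
(* [RRec] needs a first argument as counter. The empty environment has none: there the counter reads
   the default 0 and [I] reduces to [F]. *)
case=> [|k].
  have [p pP] := cF 0; exists p => xs.
  by have := pP xs; rewrite tuple0.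
have [p pP] := cF k; have [q qP] := cH k.+2.
exists (RRec p q) => xs /=.
exists (fun n => iteri n (fun i a => H i a (behead xs)) (F (behead xs))).
split; [exact: (pP (behead_tuple xs))| |by case/tupleP: xs].
move=> i _; set t := [tuple of _]; exact: (qP t).
Qed.

(** * Arithmetic, Boolean connectives and bounded search *)

Notation cpred P := (cfun (fun e => nat_of_bool (P e))).

Lemma cfun_iter N H F :
    cfun N -> cfun (fun e => H (nth 0 e 0) (behead e)) -> cfun F ->
  cfun (fun e => iter (N e) (fun a => H a e) (F e)).
Proof.
move=> cN cH cF.
have cH' : cfun (fun e => H (nth 0 e 1) (behead (behead e))).
  by apply: (cfun_ext _ (cfun_behead cH)) => e; rewrite nth_behead.
apply: (cfun_ext _ (@cfun_iteri N (fun _ a e => H a e) F cN cH' cF)) => e.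
by elim: (N e) => //= n ->.
Qed.

Lemma cfun_add F G : cfun F -> cfun G -> cfun (fun e => F e + G e).
Proof.
move=> cF cG; apply: (@cfun_ext (fun e => iter (F e) (fun a => a.+1) (G e))).
  by move=> e; elim: (F e) => //= n ->.
apply: cfun_iter => //; apply: cfun_succ; exact: cfun_nth.
Qed.

Lemma cfun_mul F G : cfun F -> cfun G -> cfun (fun e => F e * G e).
Proof.
move=> cF cG; apply: (@cfun_ext (fun e => iter (F e) (fun a => G e + a) 0)).
  by move=> e; elim: (F e) => //= n ->; rewrite mulSn.
apply: (@cfun_iter F (fun a e => G e + a)) => //; last exact: cfun_const.
by apply: cfun_add; [apply: cfun_behead | apply: cfun_nth].
Qed.

Lemma cfun_exp2 F : cfun F -> cfun (fun e => 2 ^ F e).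
Proof.
move=> cF; apply: (@cfun_ext (fun e => iter (F e) (fun a => 2 * a) 1)).
  by move=> e; elim: (F e) => //= n ->; rewrite expnS.
apply: (@cfun_iter F (fun a e => 2 * a)) => //; last exact: cfun_const.
by apply: cfun_mul; [apply: cfun_const | apply: cfun_nth].
Qed.

Lemma cfun_pred F : cfun F -> cfun (fun e => (F e).-1).
Proof.
move=> cF; apply: (@cfun_ext (fun e => iteri (F e) (fun i _ => i) 0)).
  by move=> e; case: (F e).
by apply: (@cfun_iteri F (fun i _ _ => i)) => //;
  [apply: cfun_nth | apply: cfun_const].
Qed.

Lemma cfun_sub F G : cfun F -> cfun G -> cfun (fun e => F e - G e).
Proof.
move=> cF cG; apply: (@cfun_ext (fun e => iter (G e) predn (F e))).
  by move=> e; elim: (G e) => [|n IHn] /=; rewrite ?subn0 // subnS IHn.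
by apply: (@cfun_iter G (fun a _ => a.-1)) => //; apply/cfun_pred/cfun_nth.
Qed.

Lemma cfun_not P : cpred P -> cpred (fun e => ~~ P e).
Proof.
move=> cP; apply: (@cfun_ext (fun e => 1 - P e)) => [e|]; first by case: (P e).
by apply: cfun_sub => //; apply: cfun_const.
Qed.

Lemma cfun_and P Q : cpred P -> cpred Q -> cpred (fun e => P e && Q e).
Proof.
move=> cP cQ; apply: (cfun_ext _ (cfun_mul cP cQ)) => e.
by case: (P e); case: (Q e).
Qed.

Lemma cfun_or P Q : cpred P -> cpred Q -> cpred (fun e => P e || Q e).
Proof.
move=> cP cQ; apply: (cfun_ext _ (cfun_not (cfun_and (cfun_not cP) (cfun_not cQ)))) => e.
by case: (P e); case: (Q e).
Qed.

Lemma cfun_leq F G : cfun F -> cfun G -> cpred (fun e => F e <= G e).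
Proof.
move=> cF cG; apply: (@cfun_ext (fun e => 1 - (F e - G e))) => [e|]; first by lia.
by apply: cfun_sub; [apply: cfun_const | apply: cfun_sub].
Qed.

Lemma cfun_eq F G : cfun F -> cfun G -> cpred (fun e => F e == G e).
Proof.
move=> cF cG; apply: (cfun_ext _ (cfun_and (cfun_leq cF cG) (cfun_leq cG cF))) => e.
by rewrite eqn_leq.
Qed.

(** Bounded search in the form that [RMu] minimizes: the stopping condition [n <= i] or [P i] is met
    at [n] at the latest, and [find] also returns [n] on failure. *)
Lemma find_iotaP n (P : pred nat) (i := find P (iota 0 n)) :
  (n <= i) || P i /\ forall j, j < i -> (j < n) && ~~ P j.
Proof.
have lein : i <= n by rewrite -[n in _ <= n](size_iota 0) find_size.
split=> [|j ltji]; first case: leqP => //= ltin.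
  by have := ltin; rewrite -[n in _ < n](size_iota 0) -has_find => /(nth_find 0);
    rewrite nth_iota.
have ltjn := leq_trans ltji lein; rewrite ltjn.
by have := before_find 0 ltji; rewrite nth_iota // => ->.
Qed.

Lemma cfun_find N P :
    cfun N -> cpred (fun e => P (nth 0 e 0) (behead e)) ->
  cfun (fun e => find (fun i => P i e) (iota 0 (N e))).
Proof.
move=> cN cP k.
have cB : cpred (fun e => ~~ ((N (behead e) <= nth 0 e 0)
                            || P (nth 0 e 0) (behead e))).
  by apply: cfun_not; apply: cfun_or => //; apply: cfun_leq;
     [apply: cfun_behead | apply: cfun_nth].
have [p pP] := cB k.+1; exists (RMu p) => xs /=.
have [done_i before_i] := find_iotaP (N xs) (P^~ xs); split=> [|j ltj].
  by have := pP [tuple of find (P^~ xs) (iota 0 (N xs)) :: xs]; rewrite /= done_i.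
have /andP[ltjN /negPf nPj] := before_i j ltj.
by exists 0; have := pP [tuple of j :: xs]; rewrite /= leqNgt ltjN nPj.
Qed.

Notation bexn n P := (has P (iota 0 n)).

Lemma bexnP n (P : pred nat) : reflect (exists2 i, i < n & P i) (bexn n P).
Proof.
apply: (iffP hasP) => -[i]; rewrite ?mem_iota => lti Pi; exists i => //.
by rewrite mem_iota.
Qed.

Lemma cfun_bexn N P :
    cfun N -> cpred (fun e => P (nth 0 e 0) (behead e)) ->
  cpred (fun e => bexn (N e) (fun i => P i e)).
Proof.
move=> cN cP; have := cfun_leq (cfun_succ (cfun_find cN cP)) cN.
by apply: cfun_ext => e; rewrite has_find size_iota.
Qed.

(** * Semidecidable predicates and codes of lists *)

(** The effect of [cons] on the codes of [CodeSeq]. It serves as well as a pairing function, with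
    values the positive numbers. *)
Definition consc x v := 2 ^ x * (2 * v).+1.

Lemma cfun_consc F G : cfun F -> cfun G -> cfun (fun e => consc (F e) (G e)).
Proof.
move=> cF cG; apply: cfun_mul; first exact: cfun_exp2.
by apply: cfun_succ; apply: cfun_mul => //; apply: cfun_const.
Qed.

Lemma cfun_nth_behead E i :
  cfun (fun e => nth 0 (E e) i.+1) -> cfun (fun e => nth 0 (behead (E e)) i).
Proof. by apply: cfun_ext => e; rewrite nth_behead. Qed.

Ltac cf_user := fail.

Ltac cf_tac := repeat
  match goal with
  | |- cfun (fun _ => ?n) => exact: cfun_const
  | |- cfun (fun e => nth 0 e _) => exact: cfun_nth
  | |- cfun (fun e => nth 0 (behead _) _) => apply: cfun_nth_behead
  | |- cfun (fun e => nat_of_bool (_ && _)) => apply: cfun_and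
  | |- cfun (fun e => nat_of_bool (_ || _)) => apply: cfun_or
  | |- cfun (fun e => nat_of_bool (~~ _)) => apply: cfun_not
  | |- cfun (fun e => nat_of_bool (_ <= _)) => apply: cfun_leq
  | |- cfun (fun e => nat_of_bool (_ == _)) => apply: cfun_eq
  | |- cfun (fun e => nat_of_bool (bexn _ _)) => apply: cfun_bexn
  | |- cfun (fun e => _.+1) => apply: cfun_succ
  | |- cfun (fun e => _ + _) => apply: cfun_add
  | |- cfun (fun e => _ * _) => apply: cfun_mul
  | |- cfun (fun e => 2 ^ _) => apply: cfun_exp2
  | |- cfun (fun e => consc _ _) => apply: cfun_consc
  | |- cfuns (fun e => _ :: _) => apply: cfuns_cons
  | |- cfuns behead => exact: (cfuns_behead cfuns_id)
  | |- cfuns (fun e => behead _) => apply: cfuns_behead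
  | |- cfuns (fun e => e) => exact: cfuns_id
  | |- cfuns (fun=> [::]) => exact: cfuns_nil
  | _ => cf_user
  end.

Definition semidec (P : seq nat -> Prop) : Prop :=
  exists Q : seq nat -> bool, cpred Q /\ forall e, P e <-> exists s, Q (s :: e).

Lemma semidec_ext P P' : (forall e, P e <-> P' e) -> semidec P -> semidec P'.
Proof. by move=> eP [Q [cQ PQ]]; exists Q; split=> // e; rewrite -eP. Qed.

Lemma semidec_comp P H : semidec P -> cfuns H -> semidec (fun e => P (H e)).
Proof.
move=> [Q [cQ PQ]] cH.
exists (fun e => Q (nth 0 e 0 :: H (behead e))); split=> //.
apply: (cfun_comp (H := fun e => nth 0 e 0 :: H (behead e)) cQ).
apply: cfuns_cons; first exact: cfun_nth.
(* The search witness occupies the first argument, so the programs for [H] are shifted by one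
   projection; at arity 0 there is nothing to shift. *)
move=> [|k].
  have [m [gs gsP]] := cH 0; exists m, gs => xs.
  by have := gsP xs; rewrite tuple0.
have [m [gs gsP]] := cH k.
exists m, (fun i => RComp (gs i) (fun j => RProj (lift ord0 j))) => xs.
have [sz gsE] := gsP (behead_tuple xs); split=> [//|i].
exists (behead_tuple xs) => // j /=.
by rewrite !(tnth_nth 0) /= nth_behead.
Qed.

Lemma semidec_bool P : cpred P -> semidec P.
Proof.
move=> cP; exists (fun e => P (behead e)); split; last first.
  by move=> e; split=> [Pe|[]//]; exists 0.
exact: (cfun_behead cP).
Qed.

Lemma semidec_eq F G : cfun F -> cfun G -> semidec (fun e => F e = G e).
Proof.
move=> cF cG; apply: (semidec_ext _ (semidec_bool (cfun_eq cF cG))) => e.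
by split=> /eqP.
Qed.

Lemma semidec_or P P' : semidec P -> semidec P' -> semidec (fun e => P e \/ P' e).
Proof.
move=> [Q [cQ PQ]] [Q' [cQ' PQ']]; exists (fun e => Q e || Q' e).
split; first exact: cfun_or.
move=> e; rewrite PQ PQ'; split=> [[] [s Qs]|[s /orP[]]].
- by exists s; rewrite Qs.
- by exists s; rewrite Qs orbT.
- by left; exists s.
- by right; exists s.
Qed.

(** The new witness is a common bound, below which both old witnesses are searched for. *)
Lemma semidec_and P P' : semidec P -> semidec P' -> semidec (fun e => P e /\ P' e).
Proof.
move=> [Q [cQ PQ]] [Q' [cQ' PQ']].
exists (fun e => bexn (nth 0 e 0) (fun t => Q (t :: behead e)) &&
                 bexn (nth 0 e 0) (fun t => Q' (t :: behead e))).
split; first by cf_tac; [apply: (cfun_comp cQ) | apply: (cfun_comp cQ')]; cf_tac.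
move=> e /=; rewrite PQ PQ'; split=> [[[s Qs] [t Qt]]|[s /andP[]]].
  exists (maxn s t).+1; apply/andP; split; apply/bexnP.
    by exists s => //; rewrite ltnS leq_maxl.
  by exists t => //; rewrite ltnS leq_maxr.
by move=> /bexnP[t _ Qt] /bexnP[u _ Qu]; split; [exists t | exists u].
Qed.

Lemma semidec_ex P :
  semidec (fun e => P (nth 0 e 0) (behead e)) -> semidec (fun e => exists x, P x e).
Proof.
move=> [Q [cQ PQ]].
exists (fun e => bexn (nth 0 e 0) (fun x => bexn (nth 0 e 0) (fun t =>
  Q (t :: x :: behead e)))).
split; first by cf_tac; apply: (cfun_comp cQ); cf_tac.
move=> e /=; split=> [[x /(PQ (x :: e)) [s Qs]]|].
  exists (maxn x s).+1; apply/bexnP; exists x; first by rewrite ltnS leq_maxl.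
  by apply/bexnP; exists s => //; rewrite ltnS leq_maxr.
move=> [s /bexnP[x _ /bexnP[t _ Qt]]]; exists x; apply/(PQ (x :: e)).
by exists t.
Qed.

Lemma bound_witnesses n (P : nat -> nat -> Prop) :
    (forall x, x < n -> exists s, P x s) ->
  exists m, forall x, x < n -> exists2 s, s < m & P x s.
Proof.
elim: n => [|n IHn] exP; first by exists 0.
have [|m mP] := IHn; first by move=> x ltxn; apply/exP/ltnW.
have [s sP] := exP n (ltnSn n); exists (maxn m s.+1) => x.
rewrite ltnS leq_eqVlt => /predU1P[->|/mP[t lttm tP]].
  by exists s; rewrite // leq_maxr.
by exists t; rewrite // leq_max lttm.
Qed.

(** Finitely many witnesses have a common bound, so the existential quantifier over this bound moves
    outside the bounded universal one. *)
Lemma semidec_ball N P :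
    cfun N -> semidec (fun e => P (nth 0 e 0) (behead e)) ->
  semidec (fun e => forall x, x < N e -> P x e).
Proof.
move=> cN [Q [cQ PQ]].
exists (fun e => ~~ bexn (N (behead e)) (fun x => ~~ bexn (nth 0 e 0) (fun t =>
  Q (t :: x :: behead e)))).
split.
  have cN' := cfun_behead cN.
  by cf_tac; [exact: cN' | apply: (cfun_comp cQ); cf_tac].
move=> e /=; split=> [allP|[s /bexnP nQ] x ltxN].
  have [x ltxN|m mP] := @bound_witnesses (N e) (fun x s => Q (s :: x :: e)).
    exact/(PQ (x :: e))/allP.
  exists m; apply/bexnP => -[x ltxN /bexnP[]].
  by have [s] := mP x ltxN; exists s.
apply/(PQ (x :: e)); apply: contrapT => nQx; apply: nQ; exists x => //.
by apply/bexnP => -[t _ Qt]; apply: nQx; exists t.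
Qed.

(** Uniformization: [RMu] finds the least bound [t] below which some value and its witness both
    occur ([D]), and [V] takes the least such value below [t]. The value returned need not be the
    [y] whose existence starts the search. *)
Lemma semidec_select P k :
    semidec (fun e => P (nth 0 e 0) (behead e)) ->
  exists p : recfun k, forall xs : k.-tuple nat,
    (forall y, eval p xs y -> P y xs) /\
    (forall y, P y xs -> exists y', eval p xs y').
Proof.
move=> [Q [cQ PQ]].
pose E e := bexn (nth 0 e 0) (fun s => Q (s :: behead e)).
pose D e := bexn (nth 0 e 0) (fun y =>
  bexn (nth 0 e 0) (fun s => Q (s :: y :: behead e))).
pose V e := find (fun y => bexn (nth 0 e 0) (fun s => Q (s :: y :: behead e)))
                 (iota 0 (nth 0 e 0)).
(* [RMu] looks for a zero, hence the negation of [D]. *)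
have [p pP] : exists p : recfun k.+1, forall xs, eval p xs (~~ D xs).
  by apply: (cfun_not (P := D)); rewrite /D; cf_tac; apply: (cfun_comp cQ);
    cf_tac.
have [q qP] : exists q : recfun k.+1, forall xs, eval q xs (V xs).
  suff cV : cfun V by exact: cV.
  by apply: cfun_find; cf_tac; apply: (cfun_comp cQ); cf_tac.
exists (RComp q (fun i => if unlift ord0 i is Some j then RProj j else RMu p)).
move=> xs; split=> y.
  case=> ts tsP /(eval_det (qP ts)) <-.
  have ets : tval ts = thead ts :: xs.
    case/tupleP: ts tsP => t ts tsP /=; rewrite theadE; congr (_ :: tval _).
    apply: eq_from_tnth => i; have := tsP (lift ord0 i).
    by rewrite liftK tnthS.
  have := tsP ord0; rewrite unlift_none => -[].
  move=> /(eval_det (pP _)) /eqP; rewrite eqb0 negbK => Dt _.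
  rewrite /V ets /=.
  have {Dt}: D (thead ts :: xs) by [].
  rewrite /D /= => hasD; have := nth_find 0 hasD.
  rewrite has_find size_iota in hasD; rewrite nth_iota // => /bexnP[s _ Qs].
  by apply/(PQ (_ :: xs)); exists s.
move=> /(PQ (y :: xs))[s Qs].
have exD : exists t, D (t :: xs).
  exists (maxn y s).+1; apply/bexnP; exists y; first by rewrite ltnS leq_maxl.
  by apply/bexnP; exists s => //; rewrite ltnS leq_maxr.
case: (ex_minnP exD) => t Dt t_min.
exists (V (t :: xs)), [tuple of t :: xs]; last exact: (qP [tuple of t :: xs]).
move=> i; case: unliftP => [j|] ->; first by rewrite tnthS.
split=> [|j ltjt].
  by have := pP [tuple of t :: xs]; rewrite /= Dt.
exists 0; have := pP [tuple of j :: xs] => /=; case: (boolP (D _)) => //.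
by move=> /t_min; rewrite leqNgt ltjt.
Qed.

(** * Membership in coded lists *)

Lemma code_cons x s : CodeSeq.code (x :: s) = consc x (CodeSeq.code s).
Proof. by rewrite /consc /= mul2n. Qed.

Lemma consc_inj x v x' v' : consc x v = consc x' v' -> x = x' /\ v = v'.
Proof.
rewrite -[v]CodeSeq.decodeK -[v']CodeSeq.decodeK -!code_cons.
by move=> /(can_inj CodeSeq.codeK) [-> ->].
Qed.

Lemma consc_gt x v : x < consc x v /\ v < consc x v.
Proof.
have lt_exp := ltn_expl x (isT : 1 < 2); rewrite /consc.
split; nia.
Qed.

Lemma consc_gt0 x v : 0 < consc x v.
Proof. by rewrite muln_gt0 expn_gt0. Qed.

Definition memc n w := n \in CodeSeq.decode w.

Lemma memc_cons n x v : memc n (consc x v) = (n == x) || memc n v.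
Proof. by rewrite /memc -[v]CodeSeq.decodeK -code_cons !CodeSeq.codeK inE. Qed.

Lemma memc_code n s : memc n (CodeSeq.code s) = (n \in s).
Proof. by rewrite /memc CodeSeq.codeK. Qed.

Lemma memc_lt n w : memc n w -> n < w.
Proof.
rewrite /memc -{2}[w]CodeSeq.decodeK => w_n.
by have /allP := CodeSeq.ltn_code (CodeSeq.decode w); apply.
Qed.

(* In binary, [consc x v] is [v], then a digit 1, then [x] digits 0; so the codes
   of the proper suffixes of [s] are what remains of [code s] to the left of
   one of its digits 1. *)
Lemma consc_cut x c v :
  (exists l j, l < 2 ^ j /\ consc x c = l + consc j v) <->
  (c = v \/ exists l j, l < 2 ^ j /\ c = l + consc j v).
Proof.
have cns0 u : consc 0 u = (2 * u).+1 by rewrite /consc mul1n.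
have cnsS y u : consc y.+1 u = 2 * consc y u by rewrite /consc expnS mulnA.
have exp0 : 2 ^ 0 = 1 by [].
split.
  elim: x => [|x IHx] [l [[|j]]]; rewrite ?cns0 ?cnsS ?expnS => -[ltl ec].
  - by left; lia.
  - right; exists l./2, j; split; lia.
  - lia.
  - apply: IHx; exists l./2, j; split; lia.
move=> cv; elim: x => [|x [l [j [ltl ec]]]].
  case: cv => [->|[l [j [ltl ec]]]]; first by exists 0, 0.
  exists (2 * l).+1, j.+1; rewrite cns0 cnsS expnS; split; lia.
exists (2 * l), j.+1; rewrite !cnsS expnS; split; lia.
Qed.

(** Some suffix of the list begins with [n]: either the whole list or a proper suffix as in
    [consc_cut]. All quantified numbers can be taken below [w], which makes membership
    computable. *)
Lemma memcP n w :
  memc n w <-> exists u,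
    w = consc n u \/ exists l j, l < 2 ^ j /\ w = l + consc j (consc n u).
Proof.
rewrite -[w]CodeSeq.decodeK; elim: (CodeSeq.decode w) => {w} [|x s IHs].
  split=> // -[u [e|[l [j [_ e]]]]]; have := consc_gt0 n u.
    by rewrite -e.
  by have := consc_gt0 j (consc n u); rewrite /= in e; lia.
rewrite code_cons memc_cons; split=> [/predU1P[->|/IHs[u Hu]]|[u Hu]].
- by exists (CodeSeq.code s); left.
- by exists u; right; apply/consc_cut.
- case: Hu => [/consc_inj[-> _]|/consc_cut Hu]; first by rewrite eqxx.
  by rewrite (IHs.2 (ex_intro _ u Hu)) orbT.
Qed.

Lemma cfun_memc F G : cfun F -> cfun G -> cpred (fun e => memc (F e) (G e)).
Proof.
move=> cF cG.
have /cfun_comp cM : cpred (fun e => bexn (nth 0 e 1) (fun u =>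
    (nth 0 e 1 == consc (nth 0 e 0) u) ||
    bexn (nth 0 e 1) (fun l => bexn (nth 0 e 1) (fun j =>
      (l < 2 ^ j) && (nth 0 e 1 == l + consc j (consc (nth 0 e 0) u)))))).
  by cf_tac.
have cFG : cfuns (fun e => [:: F e; G e]).
  by apply: cfuns_cons => //; apply: cfuns_cons => //; exact: cfuns_nil.
apply: (cfun_ext _ (cM _ cFG)) => e /=; congr nat_of_bool.
apply/bexnP/idP => [[u _ Hu]|/memcP[u Hu]].
  apply/memcP; exists u; case/orP: Hu => [/eqP->|]; first by left.
  by move=> /bexnP[l _ /bexnP[j _ /andP[ltl /eqP eG]]]; right; exists l, j.
have [_ ltu] := consc_gt (F e) u.
case: Hu => [eG|[l [j [ltl eG]]]].
  by exists u; rewrite eG ?ltu // eqxx.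
have [ltj ltc] := consc_gt j (consc (F e) u).
exists u; first by rewrite eG; lia.
apply/orP; right; apply/bexnP; exists l; first by lia.
by apply/bexnP; exists j; [lia | rewrite ltl eG eqxx].
Qed.

Ltac cf_user ::=
  match goal with
  | |- cfun (fun e => nat_of_bool (memc _ _)) => apply: cfun_memc
  end.

Ltac sd_user := fail.

Ltac sd_tac := repeat
  match goal with
  | |- semidec (fun e => exists x, _) => apply: semidec_ex
  | |- semidec (fun e => _ /\ _) => apply: semidec_and
  | |- semidec (fun e => _ \/ _) => apply: semidec_or
  | |- semidec (fun e => forall x, is_true (x < _) -> _) => apply: semidec_ball
  | |- semidec (fun e => is_true _) => apply: semidec_bool
  | |- semidec (fun e => _ = _) => apply: semidec_eq
  | |- semidec _ => sd_user
  | |- cfun _ => progress cf_tac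
  end.

(** * A universal relation *)

Definition triple_code c X y := consc c (consc X y).

(* The evaluation rules of [recfun] on codes, whose tags 0-5 follow the
   constructors; tag 6 evaluates a list of codes to the list of values.  The
   premises of a rule are in [M].  Every rule recurses on a smaller code, or on
   the same code and a smaller counter, so a set of triples closed under
   justification is sound although no order is imposed on it. *)
Definition justified (M : nat -> nat -> nat -> Prop) c X y : Prop :=
  (c = consc 0 0 /\ y = 0) \/
  (c = consc 1 0 /\ exists a v, X = consc a v /\ y = a.+1) \/
  (c = consc 2 0 /\ exists v, X = consc y v) \/
  (exists i, c = consc 2 i.+1 /\ exists a v, X = consc a v /\ M (consc 2 i) v y) \/
  (exists f g Y, c = consc 3 (consc f g) /\ M (consc 6 g) X Y /\ M f Y y) \/
  (exists f g v, c = consc 4 (consc f g) /\ X = consc 0 v /\ M f v y) \/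
  (exists f g n v s, c = consc 4 (consc f g) /\ X = consc n.+1 v /\
     M c (consc n v) s /\ M g (consc n (consc s v)) y) \/
  (exists f, c = consc 5 f /\ M f (consc y X) 0 /\
     forall i, i < y -> exists v, M f (consc i X) v.+1) \/
  (c = consc 6 0 /\ y = 0) \/
  (exists f g v Y, c = consc 6 (consc f g) /\ y = consc v Y /\
     M f X v /\ M (consc 6 g) X Y).

Definition holds w c X y := memc (triple_code c X y) w.

(** The bounds lose nothing, as the components of a triple in [w] are below [w]; together with the
    disjunction in place of an implication they make closedness semidecidable. *)
Definition closed w :=
  forall c, c < w -> forall X, X < w -> forall y, y < w ->
  ~~ holds w c X y \/ justified (holds w) c X y.

Definition derives c X y := exists w, closed w /\ holds w c X y.

Lemma semidec_derives F G H : cfun F -> cfun G -> cfun H ->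
  semidec (fun e => derives (F e) (G e) (H e)).
Proof.
move=> cF cG cH.
have /semidec_comp sR : semidec (fun e => derives (nth 0 e 0) (nth 0 e 1) (nth 0 e 2)).
  by rewrite /derives /closed /justified /holds /triple_code; sd_tac.
have cFGH : cfuns (fun e => [:: F e; G e; H e]).
  by do 3 apply: cfuns_cons => //; exact: cfuns_nil.
exact: (sR _ cFGH).
Qed.

Ltac sd_user ::=
  match goal with
  | |- semidec (fun e => derives _ _ _) => apply: semidec_derives
  end.

Lemma justified_mono (M M' : nat -> nat -> nat -> Prop) c X y :
    (forall c X y, M c X y -> M' c X y) -> justified M c X y -> justified M' c X y.
Proof.
move=> MM'; rewrite /justified.
case=> [|[|[|[|[|[|[|[|[]]]]]]]]] H.
- by left.
- by do 1 right; left.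
- by do 2 right; left.
- case: H => [i [-> [a [v [-> /MM' H]]]]].
  by do 3 right; left; exists i; split=> //; exists a, v.
- case: H => [f [g [Y [-> [/MM' H1 /MM' H2]]]]].
  by do 4 right; left; exists f, g, Y.
- case: H => [f [g [v [-> [-> /MM' H1]]]]].
  by do 5 right; left; exists f, g, v.
- case: H => [f [g [n [v [s [-> [-> [/MM' H1 /MM' H2]]]]]]]].
  by do 6 right; left; exists f, g, n, v, s.
- case: H => [f [-> [/MM' H1 H2]]]; do 7 right; left; exists f; do !split=> //.
  by move=> i /H2[v /MM' H3]; exists v.
- by do 8 right; left.
- case: H => [f [g [v [Y [-> [-> [/MM' H1 /MM' H2]]]]]]].
  by do 9 right; exists f, g, v, Y.
Qed.

Lemma closedP w :
  closed w <-> forall c X y, holds w c X y -> justified (holds w) c X y.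
Proof.
split=> [clw c X y w_cXy|clw c _ X _ y _]; last first.
  by case: (boolP (holds w c X y)) => [/clw|]; [right | left].
have lt_w := memc_lt w_cXy; have [ltc ltXy] := consc_gt c (consc X y).
have [ltX lty] := consc_gt X y; rewrite /triple_code in lt_w.
case: (clw c _ X _ y _); rewrite ?w_cXy //; lia.
Qed.

Lemma closed_union w w' : closed w -> closed w' ->
  exists u, [/\ closed u, forall c X y, holds w c X y -> holds u c X y
              & forall c X y, holds w' c X y -> holds u c X y].
Proof.
move=> /closedP clw /closedP clw'.
exists (CodeSeq.code (CodeSeq.decode w ++ CodeSeq.decode w')).
set u := CodeSeq.code _.
have wu c X y : holds w c X y -> holds u c X y.
  by rewrite /holds memc_code mem_cat => wn; apply/orP; left.
have w'u c X y : holds w' c X y -> holds u c X y.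
  by rewrite /holds memc_code mem_cat => wn; apply/orP; right.
split=> //; apply/closedP => c X y.
rewrite {1}/holds memc_code mem_cat => /orP[/clw|/clw'] H.
  exact: justified_mono wu H.
exact: justified_mono w'u H.
Qed.

(** From right to left: the finitely many premises have closed sets that merge by [closed_union],
    and the triple itself can then be added, being justified by the union. *)
Lemma derives_justified c X y : derives c X y <-> justified derives c X y.
Proof.
split=> [[w [clw wcXy]]|].
  apply: (@justified_mono (holds w)) => [c' X' y' H|]; first by exists w.
  exact: (closedP w).1.
move=> H; suff [w [clw jw]] : exists w, closed w /\ justified (holds w) c X y.
  exists (consc (triple_code c X y) w); split; last by rewrite /holds memc_cons eqxx.
  have sub c' X' y' :
      holds w c' X' y' -> holds (consc (triple_code c X y) w) c' X' y'.
    by rewrite /holds memc_cons => ->; rewrite orbT.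
  apply/closedP => c' X' y'; rewrite {1}/holds memc_cons.
  case/predU1P => [/consc_inj[-> /consc_inj[-> ->]]|w'].
    exact: justified_mono sub jw.
  by apply: (justified_mono sub); apply: (closedP w).1.
have two c1 X1 y1 c2 X2 y2 : derives c1 X1 y1 -> derives c2 X2 y2 ->
    exists w, closed w /\ (holds w c1 X1 y1 /\ holds w c2 X2 y2).
  move=> [w [clw w1]] [w' [clw' w2]].
  have [u [clu wu w'u]] := closed_union clw clw'.
  by exists u; split=> //; split; [apply: wu | apply: w'u].
rewrite /justified in H *.
case: H => [|[|[|[|[|[|[|[|[]]]]]]]]] H; last first.
- case: H => [f [g [v [Y [-> [-> [H1 H2]]]]]]].
  have [w [clw [w1 w2]]] := two _ _ _ _ _ _ H1 H2.
  by exists w; split=> //; do 9 right; exists f, g, v, Y.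
- by exists 0; split=> //; do 8 right; left.
- case: H => [f [-> [[w [clw H1]] H2]]].
  suff [u [clu [u1 u2]]] : exists u, closed u /\ (holds u f (consc y X) 0 /\
      forall i, i < y -> exists v, holds u f (consc i X) v.+1).
    by exists u; split=> //; do 7 right; left; exists f.
  (* The minimization rule has one premise for each [i < y] besides the first; their closed sets are
     merged one at a time. *)
  elim: {1 4}y (leqnn y) => [_|n IHn ltny]; first by exists w.
  have [u [clu [u1 u2]]] := IHn (ltnW ltny).
  have [v [u' [clu' H3]]] := H2 n ltny.
  have [u'' [clu'' uu'' u'u'']] := closed_union clu clu'.
  exists u''; split=> //; split; first exact: uu''.
  move=> i; rewrite ltnS leq_eqVlt => /predU1P[->|/u2[v' /uu'' H4]].
    by exists v; exact: u'u''.
  by exists v'.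
- case: H => [f [g [n [v [s [-> [-> [H1 H2]]]]]]]].
  have [w [clw [w1 w2]]] := two _ _ _ _ _ _ H1 H2.
  by exists w; split=> //; do 6 right; left; exists f, g, n, v, s.
- case: H => [f [g [v [-> [-> [w [clw H1]]]]]]].
  by exists w; split=> //; do 5 right; left; exists f, g, v.
- case: H => [f [g [Y [-> [H1 H2]]]]].
  have [w [clw [w1 w2]]] := two _ _ _ _ _ _ H1 H2.
  by exists w; split=> //; do 4 right; left; exists f, g, Y.
- case: H => [i [-> [a [v [-> [w [clw H1]]]]]]].
  by exists w; split=> //; do 3 right; left; exists i; split=> //; exists a, v.
- by exists 0; split=> //; do 2 right; left.
- by exists 0; split=> //; do 1 right; left.
- by exists 0; split=> //; left.
Qed.

(** * Program codes and agreement of [derives] with [eval] *)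

Fixpoint enc k (p : recfun k) : nat :=
  match p with
  | RZero _ => consc 0 0
  | RSucc => consc 1 0
  | RProj _ i => consc 2 i
  | RComp _ m f gs =>
      consc 3 (consc (enc f) (CodeSeq.code [seq enc (gs i) | i <- enum 'I_m]))
  | RRec _ f g => consc 4 (consc (enc f) (enc g))
  | RMu _ f => consc 5 (enc f)
  end.

Arguments CodeSeq.code : simpl never.

Ltac invert_just :=
  rewrite ?code_cons; move=> /derives_justified; rewrite /justified;
  let H := fresh in move=> H;
  repeat match goal with
  | H : _ \/ _ |- _ => destruct H as [H|H]
  | H : exists _, _ |- _ => destruct H as [? H]
  | H : _ /\ _ |- _ => destruct H as [? H]
  | H : consc _ _ = consc _ _ |- _ => apply consc_inj in H; destruct H
  | H : _.+1 = _.+1 |- _ => apply succn_inj in H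
  end; try discriminate; subst.

Lemma derives_zero X y : derives (consc 0 0) X y <-> y = 0.
Proof.
split; last by move=> ->; apply/derives_justified; left.
by invert_just.
Qed.

Lemma derives_succ X y :
  derives (consc 1 0) X y <-> exists a v, X = consc a v /\ y = a.+1.
Proof.
split; last by move=> H; apply/derives_justified; right; left.
by invert_just; do 2 eexists.
Qed.

Lemma derives_proj i xs y : i < size xs ->
  derives (consc 2 i) (CodeSeq.code xs) y <-> y = nth 0 xs i.
Proof.
elim: i xs => [|i IHi] [|x xs] //= ltis; split.
- by invert_just.
- move=> ->; apply/derives_justified; do 2 right; left.
  by split=> //; eexists; apply: code_cons.
- by invert_just; apply/IHi.
- move=> /IHi H; apply/derives_justified; do 3 right; left; exists i; split=> //.
  by exists x; eexists; split; [apply: code_cons | apply: H].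
Qed.

Lemma derives_list gs X Y : derives (consc 6 (CodeSeq.code gs)) X Y <->
  exists ys, [/\ Y = CodeSeq.code ys, size ys = size gs
    & forall i, i < size gs -> derives (nth 0 gs i) X (nth 0 ys i)].
Proof.
elim: gs Y => [|g gs IHgs] Y; split.
- invert_just; first by exists [::].
  by match goal with H : _ = consc ?a ?b |- _ => have := consc_gt0 a b; rewrite -H end.
- by case=> -[|? ?] [-> //= _ _]; apply/derives_justified; do 8 right; left.
- rewrite code_cons; invert_just; first by have := consc_gt0 g (CodeSeq.code gs); lia.
  match goal with H : derives (consc 6 _) _ _ |- _ => move: H end.
  case/IHgs=> ys [-> szY ysP].
  exists (x1 :: ys); split=> [| /=|[|i]]; rewrite ?code_cons ?szY //.
  exact: ysP.
- case=> -[|y ys] [-> //= [szY] ysP]; apply/derives_justified; do 9 right.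
  exists g, (CodeSeq.code gs), y, (CodeSeq.code ys); rewrite !code_cons.
  do !split=> //; first exact: (ysP 0).
  by apply/IHgs; exists ys; split=> // i lti; apply: (ysP i.+1).
Qed.

Lemma derives_comp f g X y : derives (consc 3 (consc f g)) X y <->
  exists Y, derives (consc 6 g) X Y /\ derives f Y y.
Proof.
split; last by move=> [Y ?]; apply/derives_justified; do 4 right; left; exists f, g, Y.
by invert_just; eexists; split; eassumption.
Qed.

Lemma derives_rec0 f g v y :
  derives (consc 4 (consc f g)) (consc 0 v) y <-> derives f v y.
Proof.
split; last by move=> H; apply/derives_justified; do 5 right; left; exists f, g, v.
by invert_just.
Qed.

Lemma derives_recS f g n v y : derives (consc 4 (consc f g)) (consc n.+1 v) y <->
  exists s, derives (consc 4 (consc f g)) (consc n v) s /\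
    derives g (consc n (consc s v)) y.
Proof.
split; last first.
  by move=> [s ?]; apply/derives_justified; do 6 right; left; exists f, g, n, v, s.
invert_just; eexists; split; eassumption.
Qed.

Lemma derives_mu f X y : derives (consc 5 f) X y <->
  derives f (consc y X) 0 /\
  forall i, i < y -> exists v, derives f (consc i X) v.+1.
Proof.
split; last by move=> H; apply/derives_justified; do 7 right; left; exists f.
by invert_just.
Qed.

(** Each evaluation rule mirrors a clause of [eval], so the semidecidable relation [derives] is
    universal for all programs of all arities. *)
Theorem derives_enc k (p : recfun k) (xs : k.-tuple nat) y :
  derives (enc p) (CodeSeq.code xs) y <-> eval p xs y.
Proof.
elim: p xs y => {k} [k|||||] /=.
- by move=> xs y; apply: derives_zero.
- move=> xs y; rewrite derives_succ; case/tupleP: xs => x xs; rewrite theadE.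
  rewrite code_cons; split=> [[a [v [/consc_inj[-> _] ->]]] // | ->].
  by exists x, (CodeSeq.code xs).
- by move=> k i xs y; rewrite derives_proj ?size_tuple // (tnth_nth 0).
- move=> k m f IHf gs IHgs xs y; rewrite derives_comp.
  have sz : size [seq enc (gs i) | i <- enum 'I_m] = m.
    by rewrite size_map size_enum_ord.
  have nthE (i : 'I_m) : nth 0 [seq enc (gs i) | i <- enum 'I_m] i = enc (gs i).
    by rewrite (nth_map i) ?size_enum_ord // nth_ord_enum.
  split=> [[Y [/derives_list[ys [-> szy ysP]] fy]]|[ys gys fy]].
    rewrite sz in szy ysP; have szyP : size ys == m by apply/eqP.
    exists (Tuple szyP) => [i|]; last by apply/IHf.
    by apply/IHgs; rewrite (tnth_nth 0) /= -nthE; apply: ysP.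
  exists (CodeSeq.code ys); split; last exact/IHf.
  apply/derives_list; exists ys; split=> //; first by rewrite size_tuple sz.
  rewrite sz => i lti; rewrite -[i]/(val (Ordinal lti)) nthE -tnth_nth.
  exact/IHgs.
- move=> k f IHf g IHg xs y.
  have -> : CodeSeq.code xs = consc (thead xs) (CodeSeq.code (behead_tuple xs)).
    by rewrite -code_cons; case/tupleP: xs.
  elim: (thead xs) y => [|n IHn] y.
    rewrite derives_rec0 IHf; split=> [fy|[s [f0 _ ->]] //].
    by exists (fun=> y).
  rewrite derives_recS; split=> [[z [/IHn[s [s0 sS ez]]]]|[s [s0 sS ->]]].
    rewrite -!code_cons => /(IHg [tuple of n :: z :: behead_tuple xs]) gy.
    (* The trace of the first [n] steps, extended by the final value [y]. *)
    exists (fun i => if i <= n then s i else y); split=> // [i|].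
      rewrite ltnS => lein; rewrite lein; case: ltngtP lein => // [lti|->] _.
        exact: sS.
      by rewrite -ez.
    by rewrite ltnn.
  exists (s n); split.
    by apply/IHn; exists s; split=> // i lti; apply/sS/ltnW.
  by rewrite -!code_cons; apply/(IHg [tuple of n :: s n :: behead_tuple xs])/sS.
- move=> k f IHf xs y; rewrite derives_mu -code_cons.
  rewrite (IHf [tuple of y :: xs]).
  split=> -[fy y_min]; split=> // i /y_min[v fv]; exists v.
    by apply/(IHf [tuple of i :: xs]); rewrite /= code_cons.
  by rewrite -code_cons; apply/(IHf [tuple of i :: xs]).
Qed.

(** * The numbering *)

Lemma eval_tuple2 (p : recfun 2) (xs : 2.-tuple nat) y :
  eval p [tuple tnth xs ord0; tnth xs ord_max] y <-> eval p xs y.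
Proof.
suff -> : [tuple tnth xs ord0; tnth xs ord_max] = xs by [].
apply: val_inj; case/tupleP: xs => x xs; case/tupleP: xs => x' xs.
by rewrite (tuple0 xs) !(tnth_nth 0).
Qed.

Lemma numbering_derives psi : numbering psi -> exists p : recfun 2, forall e x y,
  psi e x = Some y <-> derives (enc p) (consc e (consc x 0)) y.
Proof.
move=> [p pP]; exists p => e x y.
have := pP [tuple e; x] y; rewrite !(tnth_nth 0) /= => ->.
by rewrite -derives_enc /= !code_cons.
Qed.

Lemma semidec_numbering G :
    semidec (fun e => G (nth 0 e 1) (nth 0 e 2) (nth 0 e 0)) ->
  exists psi, [/\ numbering psi,
    forall e x y, psi e x = Some y -> G e x y
    & forall e x y, G e x y -> exists y', psi e x = Some y'].
Proof.
move=> sG.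
have {sG} : semidec (fun e => G (nth 0 (behead e) 0) (nth 0 (behead e) 1) (nth 0 e 0)).
  by apply: semidec_ext sG => e; rewrite !nth_behead.
move=> /(@semidec_select (fun y xs => G (nth 0 xs 0) (nth 0 xs 1) y) 2)[p pP].
(* Whether [p] halts is undecidable, so the option-valued function comes from classical choice; only
   its graph has to be given by a program. *)
have := @choice _ _ (fun (ex : nat * nat) (o : option nat) =>
  forall y, o = Some y <-> eval p [tuple ex.1; ex.2] y).
case=> [[e x]|psi psiP].
  have [[y py]|np] := pselect (exists y, eval p [tuple e; x] y).
    by exists (Some y) => y'; split=> [[<-]|/(eval_det py) ->].
  by exists None => y; split=> // py; case: np; exists y.
exists (fun e x => psi (e, x)); split.
- by exists p => xs y; rewrite psiP /= eval_tuple2.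
- by move=> e x y /psiP; have [+ _] := pP [tuple e; x] => /[apply].
move=> e x y Gy; have [_ /(_ y Gy)[y' py]] := pP [tuple e; x].
by exists y'; apply/psiP.
Qed.

(** * Blocks, pairings and matchings *)

Lemma cfun_dvd8 F : cfun F -> cpred (fun e => 8 %| F e).
Proof.
have /cfun_comp cD : cpred (fun e => bexn (nth 0 e 0 + 1) (fun q => nth 0 e 0 == 8 * q)).
  by cf_tac.
move=> cF; have cFs : cfuns (fun e => [:: F e]).
  by apply: cfuns_cons => //; exact: cfuns_nil.
apply: (cfun_ext _ (cD _ cFs)) => e /=; congr nat_of_bool.
apply/bexnP/idP => [[q _ /eqP->]|/dvdnP[q eF]]; first exact: dvdn_mulr.
by exists q; lia.
Qed.

(** This is [8 ^ (k + 1)], in base 2 to match [cfun_exp2]. The ratio 8 of successive blocks exceeds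
    5, so the intervals from [B] to [5 * B] are disjoint. *)
Definition block k := 2 ^ (3 * k + 3).
Definition top B x := (4 * B <= x) && ((x < 5 * B) && ~~ (8 %| x)).
Definition low B a := (B <= a) && ((a < 4 * B) && ~~ (8 %| a)).

Lemma block_uniq k k' e :
  block k <= e < 5 * block k -> block k' <= e < 5 * block k' -> k = k'.
Proof.
wlog ltkk' : k k' / k < k' => [wl|].
  by case: (ltngtP k k') => // [/wl|/wl {}wl ek ek']; [apply | symmetry; apply: wl].
have : block (k + 1) <= block k' by rewrite leq_exp2l //; lia.
have -> : block (k + 1) = 8 * block k by rewrite /block -(expnD 2 3); congr (_ ^ _); lia.
lia.
Qed.

Lemma block8 k : exists2 b, 0 < b & block k = 8 * b.
Proof. by exists (2 ^ (3 * k)); rewrite ?expn_gt0 // /block expnD mulnC. Qed.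

Lemma top_block B x : top B x -> B <= x < 5 * B.
Proof. by move=> /and3P[? ? _]; lia. Qed.

Lemma low_block B x : low B x -> B <= x < 5 * B.
Proof. by move=> /and3P[? ? _]; lia. Qed.

(* [w] codes pairs [(x, a)] that match each [x] of the top range injectively to
   some [a] of the low range outside the list with code [phi_d(x)]. *)
Definition good_pairing d m w (B := block (consc d m)) :=
  (forall x, x < 5 * B ->
     ~~ top B x \/ exists a, low B a /\ memc (consc x a) w) /\
  (forall x, x < w -> forall a, a < w ->
     ~~ memc (consc x a) w \/
     (top B x /\ (exists z, derives d (consc x 0) z /\ ~~ memc a z) /\
      forall x', x' < w -> ~~ memc (consc x' a) w \/ x = x')).

Ltac cf_user ::=
  match goal with
  | |- cfun (fun e => nat_of_bool (memc _ _)) => apply: cfun_memc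
  | |- cfun (fun e => nat_of_bool (8 %| _)) => apply: cfun_dvd8
  end.

Lemma semidec_good_pairing :
  semidec (fun e => good_pairing (nth 0 e 1) (nth 0 e 2) (nth 0 e 0)).
Proof. by rewrite /good_pairing /top /low /block; sd_tac. Qed.

Lemma good_pairing_mem d m w x a : good_pairing d m w -> memc (consc x a) w ->
  [/\ top (block (consc d m)) x, exists2 z, derives d (consc x 0) z & ~~ memc a z
    & forall x', memc (consc x' a) w -> x = x'].
Proof.
move=> [_ goodw] xa; have [ltx lta] := consc_gt x a; have ltw := memc_lt xa.
have [] := goodw x (ltn_trans ltx ltw) a (ltn_trans lta ltw).
  by rewrite xa.
move=> [topx [[z [Rz az]] ux]]; split=> //; first by exists z.
move=> x' x'a; have [ltx' _] := consc_gt x' a; have ltw' := memc_lt x'a.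
by have [] := ux x' (ltn_trans ltx' ltw'); rewrite // x'a.
Qed.

(* [c] is the code of a function choosing one good pairing for each block. *)
Definition psi_graph c e i y :=
  (exists d k, e = 8 * consc d k /\ derives d (consc k (consc i 0)) y) \/
  (exists d m, top (block (consc d m)) e /\ y = e) \/
  (exists d m w, low (block (consc d m)) e /\
     derives c (consc d (consc m 0)) w /\ memc (consc y e) w).

Lemma semidec_psi_graph c :
  semidec (fun e => psi_graph c (nth 0 e 1) (nth 0 e 2) (nth 0 e 0)).
Proof. by rewrite /psi_graph /top /low /block; sd_tac. Qed.

(** Greedy choice: the value for [x] must avoid [F x] and the values used for the rest of [T],
    together fewer than [size L]. *)
Lemma matching (T L : seq nat) (F : nat -> seq nat) : uniq L ->
    (forall x, x \in T -> size (F x) + size T <= size L) ->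
  exists a : nat -> nat, [/\ forall x, x \in T -> a x \in L,
    forall x, x \in T -> a x \notin F x & {in T &, injective a}].
Proof.
move=> uL; elim: T => [|x T IHT] ltL; first by exists id.
have [|a [aL aF a_inj]] := IHT.
  by move=> y Ty; have := ltL y (mem_behead (s := x :: T) Ty); rewrite /=; lia.
have [b] : exists b, (b \in L) && (b \notin F x ++ map a T).
  apply: contrapT => nb; have: {subset L <= F x ++ map a T}.
    by move=> b Lb; apply: contrapT => /negP nFb; apply: nb; exists b; rewrite Lb.
  move=> /(uniq_leq_size uL); rewrite size_cat size_map.
  by have := ltL x (mem_head _ _); rewrite /=; lia.
rewrite mem_cat negb_or => /and3P[Lb Fb Tb].
(* A repeated entry keeps the value that it has already. *)
have [Tx|nTx] := boolP (x \in T).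
  have sT y : y \in x :: T -> y \in T by rewrite inE => /predU1P[->|].
  by exists a; split=> [y /sT|y /sT|y y' /sT Ty /sT Ty']; auto.
exists (fun y => if y == x then b else a y); split=> [y|y|y y'].
- by rewrite inE; case: eqP => //= _ /aL.
- by rewrite inE; case: eqP => [->|_ /aF].
rewrite !inE; case: eqP => [->|_] /=; case: eqP => [->|_] //= Ty Ty'.
- by move=> eb; case/mapP: Tb; exists y'.
- by move=> eb; case/mapP: Tb; exists y.
- exact: a_inj.
Qed.

Lemma count_ndvd8 u n :
  size [seq x <- iota (8 * u) (8 * n) | ~~ (8 %| x)] = 7 * n.
Proof.
rewrite size_filter; elim: n u => [|n IHn] u; first by rewrite muln0.
have -> : 8 * n.+1 = 8 + 8 * n by lia.
rewrite iotaD count_cat (_ : 8 * u + 8 = 8 * u.+1) ?IHn; last by lia.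
suff -> : count (fun x => ~~ (8 %| x)) (iota (8 * u) 8) = 7 by lia.
rewrite -[8 * u]addn0 iotaDl count_map (@eq_count _ _ (fun x => ~~ (8 %| x))) //.
by move=> x /=; rewrite dvdn_addr // dvdn_mulr.
Qed.

(** What selection guarantees: [h] picks one good pairing per block wherever one exists, [c] is its
    code, and [psi] picks values inside [psi_graph c]. That these values are the intended ones is
    derived below, from the clauses applicable to each index. *)
Record diagonal (h psi : nat -> nat -> option nat) c : Prop := Diagonal {
  h_sound : forall d m w, h d m = Some w -> good_pairing d m w;
  h_defined : forall d m w, good_pairing d m w -> exists w', h d m = Some w';
  h_derives : forall d m w, h d m = Some w <-> derives c (consc d (consc m 0)) w;
  psi_sound : forall e i y, psi e i = Some y -> psi_graph c e i y;
  psi_defined : forall e i y, psi_graph c e i y -> exists y', psi e i = Some y'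
}.

Lemma top_not8 B x : top B x -> ~~ (8 %| x). Proof. by case/and3P. Qed.
Lemma low_not8 B x : low B x -> ~~ (8 %| x). Proof. by case/and3P. Qed.

Lemma top_not_low k k' e : top (block k) e -> low (block k') e -> False.
Proof.
move=> top_e low_e.
have ek := block_uniq (top_block top_e) (low_block low_e); rewrite ek in top_e.
by move: top_e low_e => /and3P[? _ _] /and3P[_ ? _]; lia.
Qed.

(** Only the first clause of [psi_graph] admits multiples of 8, and evaluation is deterministic, so
    the selected value is that of [p]. *)
Lemma psi_universal h psi c (D : diagonal h psi c) (p : recfun 2) k i y :
  psi (8 * consc (enc p) k) i = Some y <-> eval p [tuple k; i] y.
Proof.
rewrite -derives_enc /= !code_cons.
have R_of z : psi_graph c (8 * consc (enc p) k) i z ->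
    derives (enc p) (consc k (consc i 0)) z.
  have d8 : 8 %| 8 * consc (enc p) k by rewrite dvdn_mulr.
  case=> [[d [k' [e]]]|[[d [m [/top_not8]]]|[d [m [w [/low_not8]]]]]]; rewrite ?d8 //.
  by have /consc_inj[-> ->] : consc (enc p) k = consc d k' by lia.
split=> [/(psi_sound D)/R_of //|Ry].
have [|z pz] := psi_defined D (e := 8 * consc (enc p) k) (i := i) (y := y).
  by left; exists (enc p), k.
rewrite pz; congr Some; have Rz := R_of _ (psi_sound D pz).
apply: (@eval_det _ p [tuple k; i]); apply/derives_enc; rewrite /= !code_cons //.
Qed.

Lemma psi_top h psi c (D : diagonal h psi c) d m x i :
  top (block (consc d m)) x -> psi x i = Some x.
Proof.
move=> topx; have [|y py] := psi_defined D (e := x) (i := i) (y := x).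
  by right; left; exists d, m.
rewrite py; have := psi_sound D py.
case=> [[d' [k [e _]]]|[[d' [m' [_ -> //]]]|[d' [m' [w [low_x _]]]]]].
  by have := top_not8 topx; rewrite e dvdn_mulr.
by case: (top_not_low topx low_x).
Qed.

(** The block of [a] is unique, [h] fixes its pairing, and injectivity of the pairing leaves [x] as
    the only value at [a]. *)
Lemma psi_low h psi c (D : diagonal h psi c) d m w x a i :
    h d m = Some w -> low (block (consc d m)) a ->
  memc (consc x a) w -> psi a i = Some x.
Proof.
move=> hw low_a xa; have [|y py] := psi_defined D (e := a) (i := i) (y := x).
  by right; right; exists d, m, w; rewrite -(h_derives D).
rewrite py; congr Some; have := psi_sound D py.
case=> [[d' [k [e _]]]|[[d' [m' [topx _]]]|[d' [m' [w' [low_a']]]]]].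
- by have := low_not8 low_a; rewrite e dvdn_mulr.
- by case: (top_not_low topx low_a).
rewrite -(h_derives D).
have /consc_inj[<- <-] := block_uniq (low_block low_a) (low_block low_a').
rewrite hw => -[[<-] ya]; have [_ _ ux] := good_pairing_mem (h_sound D hw) xa.
by rewrite (ux y).
Qed.

(** The three cases are the clauses of [psi_graph] at [j]. In the last one, disjointness of blocks
    puts the pairing in the block of [x], so [j] was chosen outside the list computed by [d] at
    [x]. *)
Lemma top_value_index h psi c (D : diagonal h psi c) d m w x j i :
    h d m = Some w ->
    top (block (consc d m)) x -> psi j i = Some x ->
  [\/ 8 %| j, j = x | exists2 z, derives d (consc x 0) z & ~~ memc j z].
Proof.
move=> hw topx /(psi_sound D).
case=> [[d' [k [-> _]]]|[[d' [m' [_ ->]]]|[d' [m' [w' [low_j]]]]]].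
- by constructor 1; rewrite dvdn_mulr.
- by constructor 2.
rewrite -(h_derives D) => -[hw' xj]; constructor 3.
have [topx' Rx _] := good_pairing_mem (h_sound D hw') xj.
by have /consc_inj[-> _] := block_uniq (top_block topx) (top_block topx').
Qed.

(** * Minimal indices and the counting argument *)

Lemma min_indexP psi e : psi (min_index psi e) = psi e /\
  forall j, psi j = psi e -> min_index psi e <= j.
Proof.
rewrite /min_index; case: ex_minnP => j /asboolP -> j_min; split=> // k ek.
by apply: j_min; apply/asboolP.
Qed.

Lemma good_pairing_exists d m (f : nat -> seq nat) (B := block (consc d m)) :
    (forall x, derives d (consc x 0) (CodeSeq.code (f x))) ->
    (forall x, top B x -> size (f x) <= B) ->
  exists w, good_pairing d m w.
Proof.
move=> Rf szf; have [b b_gt0 eB] := block8 (consc d m); rewrite -/B in eB.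
pose T := [seq x <- iota (8 * (4 * b)) (8 * b) | ~~ (8 %| x)].
pose L := [seq x <- iota (8 * b) (8 * (3 * b)) | ~~ (8 %| x)].
have T_top x : (x \in T) = top B x.
  by rewrite mem_filter mem_iota /top eB; lia.
have L_low x : (x \in L) = low B x.
  by rewrite mem_filter mem_iota /low eB; lia.
have [||a [aL aF a_inj]] := @matching T L f.
- by apply: filter_uniq; exact: iota_uniq.
(* With [B = 8 * b], each list has at most [8 * b] elements and [T] has [7 * b]; their sum is below
   the size [21 * b] of [L]. *)
- by move=> x; rewrite T_top !count_ndvd8 => /szf; lia.
exists (CodeSeq.code [seq consc x (a x) | x <- T]); split=> [x _|x _ a' _].
  case: (boolP (top B x)) => [topx|]; [right|by left].
  rewrite -T_top in topx; exists (a x); rewrite -L_low aL //; split=> //.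
  by rewrite memc_code; apply/mapP; exists x.
rewrite !memc_code; case: mapP => [[x' Tx' /consc_inj[-> ->]]|]; [right|by left].
split; first by rewrite -T_top.
split; first by exists (CodeSeq.code (f x')); rewrite memc_code; split=> //; apply: aF.
move=> x'' _; rewrite memc_code; case: mapP; [|by left].
by move=> [y Ty /consc_inj[-> ea]]; right; exact: a_inj.
Qed.

Lemma long_list h psi c (D : diagonal h psi c) d m (f : nat -> seq nat)
    (B := block (consc d m)) :
    (forall x z, derives d (consc x 0) z <-> z = CodeSeq.code (f x)) ->
    (forall x, min_index psi x \in f x) ->
  exists x, top B x /\ B < size (f x).
Proof.
move=> Rf f_min; apply: contrapT => short.
have szf x : top B x -> size (f x) <= B.
  by move=> topx; rewrite leqNgt; apply/negP => lt; apply: short; exists x.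
have [|w0 /(h_defined D)[w hw]] := good_pairing_exists (f := f) _ szf.
   by move=> x; apply/Rf.
have [b b_gt0 eB] := block8 (consc d m); rewrite -/B in eB.
pose T := [seq x <- iota (8 * (4 * b)) (8 * b) | ~~ (8 %| x)].
have T_top x : x \in T -> top B x.
  by rewrite mem_filter mem_iota /top eB; lia.
have min_psi x : x \in T -> psi (min_index psi x) 0 = Some x.
  by move=> /T_top topx; rewrite (min_indexP psi x).1; exact: (psi_top D _ topx).
(* The [7 * b] minimal indices are distinct, since their values at 0 differ, yet they will all be
   among the [5 * b] multiples of 8 below [5 * B]. *)
have := @uniq_leq_size _ (map (min_index psi) T) [seq 8 * q | q <- iota 0 (5 * b)].
rewrite !size_map count_ndvd8 size_iota map_inj_in_uniq; last first.
  by move=> x y Tx Ty e; have := min_psi x Tx; rewrite e min_psi // => -[].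
rewrite filter_uniq ?iota_uniq // => /(_ isT) Hle.
suff: 7 * b <= 5 * b by lia.
apply: Hle => _ /mapP[x Tx ->]; have topx := T_top x Tx.
have [gw _] := h_sound D hw.
have [_ ltx _] := and3P topx.
case: (gw x ltx) => [|[a [low_a xa]]]; first by rewrite topx.
(* The partner [a] is below [4 * B], hence below [x], and carries the same constant function. *)
have lt_min : min_index psi x < x.
  have : min_index psi x <= a.
    apply: (min_indexP psi x).2; apply/funext => i.
    by rewrite (psi_low D _ hw low_a xa) (psi_top D _ topx).
  by move: topx low_a => /and3P[? _ _] /and3P[_ ? _]; lia.
(* Only a multiple of 8 survives: [x] itself is too large, and an index outside the list contradicts
   [f_min]. *)
have [d8|e|[z /Rf ->]] := top_value_index D hw topx (min_psi x Tx).
- apply/mapP; exists (min_index psi x %/ 8).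
    by rewrite mem_iota; lia.
  by rewrite mulnC divnK.
- by rewrite e ltnn in lt_min.
- by rewrite memc_code f_min.
Qed.

(** * The linear translation and the lower bound *)

Lemma computable_cf t : cfun (fun e => t (nth 0 e 0)) -> computable t.
Proof.
move=> /(_ 1)[p pP]; exists p => xs y; have := pP xs.
rewrite /thead (tnth_nth 0) /= => px.
by split=> [[<-]|py] //; rewrite (eval_det px py).
Qed.

Theorem theorem4p6 :
  exists psi : nat -> nat -> option nat,
    kolmogorov_numbering psi /\
    forall f : nat -> seq nat,
      computable_list f ->
      (forall x, min_index psi x \in f x) ->
      exists c : rat, (0 < c)%R /\
        forall n : nat, exists x : nat,
          n <= x /\ (c * x%:R <= (size (f x))%:R)%R.
Proof.
(* Good pairings refer to [derives] and not to [psi], so [h] is obtained first and its code [enc ph]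
   becomes a parameter of [psi_graph]. *)
have [h [/numbering_derives[ph h_derives] h_sound h_defined]] :=
  semidec_numbering (G := fun d m w => good_pairing d m w) semidec_good_pairing.
have [psi [psi_num psi_sound psi_defined]] := semidec_numbering (semidec_psi_graph (enc ph)).
have D : diagonal h psi (enc ph) by split.
exists psi; split.
  split=> // theta [p pP].
  (* Expanding [consc], the translation is [16 * 2 ^ enc p * e + 8 * 2 ^ enc p]. *)
  exists (fun e => 8 * consc (enc p) e), (16 * 2 ^ enc p); split.
  - by apply: computable_cf; cf_tac.
  - by rewrite muln_gt0 expn_gt0.
  - move=> e; apply/funext => x.
    have eqv y : psi (8 * consc (enc p) e) x = Some y <-> theta e x = Some y.
      by rewrite (psi_universal D) -pP !(tnth_nth 0).
    case: (psi _ x) eqv => [y|] eqv; first by symmetry; apply/eqv.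
    by case: (theta e x) eqv => // y /(_ y)[_ /(_ erefl)].
  - by move=> e; rewrite /consc; nia.
(* In a block, [x < 5 * B] while the long list has more than [B] elements; hence the factor 1/5. *)
move=> f [p pP] f_min; exists (1 / 5%:R)%R; split; first by lra.
have Rf x z : derives (enc p) (consc x 0) z <-> z = CodeSeq.code (f x).
  have := derives_enc p [tuple x] z; rewrite /= code_cons -pP => ->.
  by rewrite /thead (tnth_nth 0) /=; split=> [[->]|->].
move=> n.
(* Taking [n] as the second component of the block number makes [B] exceed [n], so suitable [x]
   occur beyond every bound. *)
have [x [topx lt_sz]] := long_list D n Rf f_min.
exists x; move: topx lt_sz; set B := block _ => /and3P[le_x x_lt _] lt_sz.
have ltnB : n < B.
  have [_ ltn] := consc_gt (enc p) n.
  by have := ltn_expl (3 * consc (enc p) n + 3) (isT : 1 < 2);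
    rewrite /B /block; lia.
split; first by lia.
have : x <= 5 * size (f x) by lia.
rewrite -(Num.Theory.ler_nat rat) GRing.natrM; lra.
Qed.
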